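(* Let $c\in P$ be such that $\bar H_\delta$ is differentiable at $c$, and let $\bar v=\bar v(c)$ be a time-$1$-periodic solution of the discrete cell equation. Then every minimizing random walk of $\bar v(c)$ has the backward rotation vector $\frac{\partial}{\partial c}\bar H_\delta(c)$; that is, for every $(x_n,t_{l+1})\in\tilde{\mathcal{G}}_\delta$, the average $\bar\gamma^k$ ($k\le l+1$) of the minimizing random walk for $\bar v^{l+1}_n$ satisfies $$\lim_{l'\to-\infty}\frac{\bar\gamma^{l'}}{t_{l'}}=\frac{\partial}{\partial c}\bar H_\delta(c).$$
   Context: Lagrangian: $\mathbb{T}=\mathbb{R}/\mathbb{Z}$, $\mathbb{T}^d=\mathbb{R}^d/\mathbb{Z}^d$; functions on tori are identified with $1$-periodic functions. $|x|_\infty=\max_j|x^j|$, $|\cdot|$ is the Euclidean norm. $L=L(x,t,\zeta):\mathbb{T}^d\times\mathbb{T}\times\mathbb{R}^d\to\mathbb{R}$ is $C^2$; $L_{\zeta\zeta}$ is positive definite everywhere; for each $a\ge0$ there is $b_1(a)\in\mathbb{R}$ with $L\ge a|\zeta|+b_1(a)$ everywhere; there is $\alpha>0$ with $|L_{x^j}|\le\alpha(1+|L|)$ everywhere ($j=1,\dots,d$). $H(x,t,p)=\sup_{\zeta\in\mathbb{R}^d}(p\cdot\zeta-L(x,t,\zeta))$, $L^{(c)}(x,t,\zeta)=L(x,t,\zeta)-c\cdot\zeta$. $P\subset\mathbb{R}^d$ is a fixed compact convex set and $r>0$ is a fixed number. Grid: $\delta=(h,\tau)$, $h=(2N)^{-1}$,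 $\tau=(2K)^{-1}$ with $N,K\in\mathbb{N}$, $\lambda=\tau/h$; $x_m=hm$ ($m\in\mathbb{Z}^d$), $t_k=\tau k$ ($k\in\mathbb{Z}$). $G_{\rm even}$ (resp. $G_{\rm odd}$) is the set of $x_m$ with $m^1+\dots+m^d$ even (resp. odd). $\mathcal{G}_\delta=\bigcup_{k}\{(G_{\rm even}\times\{t_{2k}\})\cup(G_{\rm odd}\times\{t_{2k+1}\})\}$, $\tilde{\mathcal{G}}_\delta=\bigcup_{k}\{(G_{\rm odd}\times\{t_{2k}\})\cup(G_{\rm even}\times\{t_{2k+1}\})\}$. $e_1,\dots,e_d$ is the standard basis, $B=\{\pm e_1,\dots,\pm e_d\}$. For a grid point $x$, $m(x)$ is its index. For $v:\tilde{\mathcal{G}}_\delta\to\mathbb{R}$ write $v^k_m=v(x_m,t_k)$ and, for $(x_m,t_k)\in\mathcal{G}_\delta$, $(D_{x^j}v)^k_m=\frac{v^k_{m+e_j}-v^k_{m-e_j}}{2h}$, $D_xv=(D_{x^1}v,\dots,D_{x^d}v)$, $(D_tv)^{k+1}_m=\frac1\tau\big(v^{k+1}_m-\frac1{2d}\sum_{\omega\in B}v^k_{m+\omega}\big)$. Random walks: for $(x_n,t_{l+1})\in\tilde{\mathcal{G}}_\delta$ and $l'\le l$, $\Omega^{l+1,l'}_n$ is the set of paths $\gamma=(\gamma^k)_{l'\le k\le l+1}$ with $\gamma^{l+1}=x_n$, $\gamma^k=\gamma^{k+1}+h\omega^{k+1}$, $\omega^{k+1}\in B$. A control $\xi$ on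 $\tilde{\mathcal{G}}_\delta$ with values in $[-(d\lambda)^{-1},(d\lambda)^{-1}]^d$ defines $\rho^{k+1}_m(\omega)=\frac1{2d}-\frac\lambda2\omega\cdot\xi^{k+1}_m$ and the probability density $\mu^{l+1,l'}_n(\gamma;\xi)=\prod_{l'\le k\le l}\rho^{k+1}_{m(\gamma^{k+1})}(\omega^{k+1})$ on $\Omega^{l+1,l'}_n$, with expectation $E_{\mu^{l+1,l'}_n(\cdot;\xi)}$. The average is $\bar\gamma^k=\sum_{\gamma\in\Omega^{l+1,l'}_n}\mu^{l+1,l'}_n(\gamma;\xi)\gamma^k\in\mathbb{R}^d$ for $l'\le k\le l+1$ (its value does not depend on the choice of $l'\le k$; paths live in $\mathbb{R}^d$). Solution map: $X_\delta$ is the set of $w:G_{\rm odd}\to\mathbb{R}$, $1$-periodic in each coordinate, with $|D_xw|_\infty\le r$ on $G_{\rm even}$. For $v^0\in X_\delta$, $c\in P$, $\varphi^k_\delta(v^0;c)=v(\cdot,t_k)$, where $(D_tv)^{k+1}_m+H(x_m,t_k,c+(D_xv)^k_m)=0$, $v(\cdot,0)=v^0$; $\varphi_\delta=\varphi^{2K}_\delta$. $\bar H_\delta(c)$ is the unique real number for which some $\bar v^0\in X_\delta$ satisfies $\varphi_\delta(\bar v^0;c)+\bar H_\delta(c)=\bar v^0$. A time-$1$-periodic solution $\bar v$ of the discrete cell equation is a function $\bar v:\tilde{\mathcal{G}}_\delta\to\mathbb{R}$, $1$-periodic in each space coordinate and in time, with $\bar v(\cdot,0)\in X_\delta$ and $(D_t\bar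 v)^{k+1}_m+H(x_m,t_k,c+(D_x\bar v)^k_m)=\bar H_\delta(c)$. Standing assumption: $r$ is large enough and $\delta$ small enough, with $\lambda<\lambda_1$ for a constant $\lambda_1=\lambda_1(r,P)>0$, so that $\varphi_\delta(\cdot;c)$ maps $X_\delta$ into itself for all $c\in P$ and, for all such $\bar v$ and all $l'\le l$, $$\bar v^{l+1}_n=\inf_\xi E_{\mu^{l+1,l'}_n(\cdot;\xi)}\Big[\sum_{l'<k\le l+1}L^{(c)}(\gamma^k,t_{k-1},\xi^k_{m(\gamma^k)})\tau+\bar v^{l'}_{m(\gamma^{l'})}\Big]+\bar H_\delta(c)(t_{l+1}-t_{l'}),$$ with unique minimizing control $\xi^{*\,k+1}_m=H_p(x_m,t_k,c+(D_x\bar v)^k_m)$, $|\xi^*|_\infty\le(d\lambda_1)^{-1}<(d\lambda)^{-1}$. The minimizing random walk for $\bar v^{l+1}_n$ is the walk generated by $\xi^*$, extended to $l'\to-\infty$. *)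

(* Defs.v *)
From HB Require Import structures.
From mathcomp Require Import all_boot all_order all_algebra.
From mathcomp Require Import all_classical all_reals all_analysis.
Set Implicit Arguments.
Unset Strict Implicit.
Unset Printing Implicit Defensive.
Import Order.TTheory GRing.Theory Num.Theory.
Import numFieldNormedType.Exports.
Local Open Scope classical_set_scope.
Local Open Scope ring_scope.

Definition evec (A : pzRingType) (d : nat) (j : 'I_d) : 'rV[A]_d :=
  delta_mx 0 j.

Section Calculus.
Variable R : realType.

Definition C1 (V : normedModType R) (f : V -> R) : Prop :=
  (forall z, differentiable f z) /\
  (forall u, continuous (fun z => 'D_u f z)).

(* All second directional derivatives exist and are continuous; in finite
   dimension this is the usual class C^2. *)
Definition C2 (V : normedModType R) (f : V -> R) : Prop :=
  C1 f /\ (forall u, C1 (fun z => 'D_u f z)).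

Variable d : nat.

Definition dotv (u v : 'rV[R]_d) : R := \sum_j u 0 j * v 0 j.

(* Euclidean norm; the norm `|v| of the library on 'rV[R]_d is the max norm. *)
Definition enorm (v : 'rV[R]_d) : R := Num.sqrt (dotv v v).

Definition grad (f : 'rV[R]_d -> R) (p : 'rV[R]_d) : 'rV[R]_d :=
  \row_j 'D_(evec R j) f p.

Definition hessian (f : 'rV[R]_d -> R) (p : 'rV[R]_d) : 'M[R]_d :=
  \matrix_(i, j) 'D_(evec R i) (fun q => 'D_(evec R j) f q) p.

Definition posdef (A : 'M[R]_d) : Prop :=
  forall u : 'rV[R]_d, u != 0 -> 0 < (u *m A *m u^T) 0 0.

End Calculus.

Section Lagrangian.
Variables (R : realType) (d : nat).
Variable L : 'rV[R]_d -> R -> 'rV[R]_d -> R.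

Record lagrangian : Prop := Lagrangian_ {
  lag_perx : forall x t zeta j, L (x + evec R j) t zeta = L x t zeta;
  lag_pert : forall x t zeta, L x (t + 1) zeta = L x t zeta;
  lag_C2 : C2 (fun z : 'rV[R]_d * R * 'rV[R]_d => L z.1.1 z.1.2 z.2);
  lag_convex : forall x t zeta, posdef (hessian (L x t) zeta);
  lag_superlinear : forall a : R, 0 <= a -> exists b1 : R,
    forall x t zeta, a * enorm zeta + b1 <= L x t zeta;
  lag_growth : exists2 alpha : R, 0 < alpha &
    forall x t zeta (j : 'I_d),
      `|'D_(evec R j) (fun y => L y t zeta) x| <= alpha * (1 + `|L x t zeta|)
}.

Definition Ham (x : 'rV[R]_d) (t : R) (p : 'rV[R]_d) : R :=
  sup [set dotv p zeta - L x t zeta | zeta in setT].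

Definition Ham_p (x : 'rV[R]_d) (t : R) (p : 'rV[R]_d) : 'rV[R]_d :=
  grad (Ham x t) p.

Definition Lag_c (c x : 'rV[R]_d) (t : R) (zeta : 'rV[R]_d) : R :=
  L x t zeta - dotv c zeta.

End Lagrangian.

(* Grid points are represented by their indices (m, k) in Z^d x Z, and a grid
   function v by a total function with v k m = v^k_m.  Values outside the
   sublattice on which the function is meant to live are never used. *)
Section Grid.
Variables (R : realType) (d N K : nat).

Definition hstep : R := (2 * N)%:R^-1.
Definition tstep : R := (2 * K)%:R^-1.
Definition lam : R := tstep / hstep.
Definition xpt (m : 'rV[int]_d) : 'rV[R]_d := hstep *: map_mx intr m.
Definition tpt (k : int) : R := tstep * k%:~R.

Definition Geven (m : 'rV[int]_d) : bool := (2 %| \sum_j m 0 j)%Z.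
Definition Godd (m : 'rV[int]_d) : bool := ~~ Geven m.

Definition Ggrid (k : int) (m : 'rV[int]_d) : bool :=
  if (2 %| k)%Z then Geven m else Godd m.
Definition Gtilde (k : int) (m : 'rV[int]_d) : bool :=
  if (2 %| k)%Z then Godd m else Geven m.

(* The set B: (j, false) encodes e_j and (j, true) encodes - e_j. *)
Definition step : Type := ('I_d * bool)%type.
Definition dir (w : step) : 'rV[int]_d := (-1) ^+ w.2 *: evec int w.1.

Definition avg (w : 'rV[int]_d -> R) (m : 'rV[int]_d) : R :=
  (2 * d)%:R^-1 * \sum_(e : step) w (m + dir e).

Definition Dx (w : 'rV[int]_d -> R) (m : 'rV[int]_d) : 'rV[R]_d :=
  \row_j ((w (m + evec int j) - w (m - evec int j)) / (2 * hstep)).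

(* Dt v k m is (D_t v)^{k+1}_m. *)
Definition Dt (v : int -> 'rV[int]_d -> R) (k : int) (m : 'rV[int]_d) : R :=
  tstep^-1 * (v (k + 1) m - avg (v k) m).

Variable L : 'rV[R]_d -> R -> 'rV[R]_d -> R.
Variable r : R.

Definition Xspace (w : 'rV[int]_d -> R) : Prop :=
  (forall m j, Godd m -> w (m + (2 * N)%:Z *: evec int j) = w m) /\
  (forall m, Geven m -> `|Dx w m| <= r).

(* The scheme (D_t v)^{k+1}_m + H(x_m, t_k, c + (D_x v)^k_m) = 0 solved for
   v^{k+1}_m; see phiP below. *)
Fixpoint phi (v0 : 'rV[int]_d -> R) (c : 'rV[R]_d) (k : nat)
    (m : 'rV[int]_d) : R :=
  if k is k'.+1 then
    avg (phi v0 c k') m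
      - tstep * Ham L (xpt m) (tpt k'%:Z) (c + Dx (phi v0 c k') m)
  else v0 m.

Definition is_Hbar (c : 'rV[R]_d) (Hb : R) : Prop :=
  exists2 v0, Xspace v0 &
    forall m, Godd m -> phi v0 c (2 * K) m + Hb = v0 m.

Definition Hbar_dom : set 'rV[R]_d := [set c | exists! Hb, is_Hbar c Hb].

(* Meaningful on Hbar_dom only. *)
Definition Hbar (c : 'rV[R]_d) : R := get [set Hb | is_Hbar c Hb].

(* Hbar is a partial function: it must be well defined near c. *)
Definition Hbar_differentiable (c : 'rV[R]_d) : Prop :=
  (\forall c' \near c, Hbar_dom c') /\ differentiable Hbar c.

Record cell_solution (c : 'rV[R]_d) (v : int -> 'rV[int]_d -> R) : Prop :=
  CellSolution {
  cell_perx : forall k m j, Gtilde k m ->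
    v k (m + (2 * N)%:Z *: evec int j) = v k m;
  cell_pert : forall k m, Gtilde k m -> v (k + (2 * K)%:Z) m = v k m;
  cell_X : Xspace (v 0);
  cell_eq : forall k m, Ggrid k m ->
    Dt v k m + Ham L (xpt m) (tpt k) (c + Dx (v k) m) = Hbar c
}.

Lemma phiP v0 c (k : nat) m : (0 < K)%N ->
  tstep^-1 * (phi v0 c k.+1 m - avg (phi v0 c k) m)
    + Ham L (xpt m) (tpt k%:Z) (c + Dx (phi v0 c k) m) = 0.
Proof.
move=> K0 /=; rewrite addrAC subrr add0r mulrN mulrA mulVf ?mul1r ?addNr //.
by rewrite invr_eq0 pnatr_eq0 -lt0n muln_gt0.
Qed.

End Grid.

Section Walk.
Variables (R : realType) (d N K : nat).

Local Notation lam := (lam R N K).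
Local Notation xpt := (@xpt R d N).
Local Notation tpt := (tpt R K).
Local Notation tstep := (tstep R K).

(* xi k m is xi^k_m *)
Definition control : Type := int -> 'rV[int]_d -> 'rV[R]_d.

Definition admissible (xi : control) : Prop :=
  forall k m, Gtilde k m -> `|xi k m| <= (d%:R * lam)^-1.

Definition rho (z : 'rV[R]_d) (w : step d) : R :=
  (2 * d)%:R^-1 - lam / 2 * dotv (map_mx intr (dir w)) z.

(* Omega^{l1,l'}_n for l' <= l1: a path is encoded by its successive steps,
   g j being omega^{l1 - j}, so that it does not depend on n. *)
Definition walk (l1 l' : int) : finType := {ffun 'I_(`|l1 - l'|%N) -> step d}.

(* m(gamma^k) for the path gamma of Omega^{l1,l'}_n encoded by g. *)
Definition site (n : 'rV[int]_d) (l1 l' : int) (g : walk l1 l') (k : int) :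
    'rV[int]_d :=
  n + \sum_(j < `|l1 - l'|%N | j%:Z < l1 - k) dir (g j).

Definition density (xi : control) (n : 'rV[int]_d) (l1 l' : int)
    (g : walk l1 l') : R :=
  \prod_(j < `|l1 - l'|%N)
    rho (xi (l1 - j%:Z) (site n g (l1 - j%:Z))) (g j).

Definition expect (xi : control) (n : 'rV[int]_d) (l1 l' : int)
    (f : walk l1 l' -> R) : R :=
  \sum_(g : walk l1 l') density xi n g * f g.

Definition mean (xi : control) (n : 'rV[int]_d) (l1 l' k : int) : 'rV[R]_d :=
  \sum_(g : walk l1 l') density xi n g *: xpt (site n g k).

(* \bar\gamma^k, computed with l' = k. *)
Definition gamma_bar (xi : control) (n : 'rV[int]_d) (l1 k : int) : 'rV[R]_d :=
  mean xi n l1 k k.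

Variable L : 'rV[R]_d -> R -> 'rV[R]_d -> R.

Definition cost (c : 'rV[R]_d) (v : int -> 'rV[int]_d -> R)
    (n : 'rV[int]_d) (l1 l' : int) (xi : control) : R :=
  expect xi n (fun g : walk l1 l' =>
    \sum_(j < `|l1 - l'|%N)
      Lag_c L c (xpt (site n g (l1 - j%:Z))) (tpt (l1 - j%:Z - 1))
        (xi (l1 - j%:Z) (site n g (l1 - j%:Z))) * tstep
    + v l' (site n g l')).

Definition min_cost (c : 'rV[R]_d) (v : int -> 'rV[int]_d -> R)
    (n : 'rV[int]_d) (l1 l' : int) : R :=
  inf [set cost c v n l1 l' xi | xi in admissible].

(* The cost only involves xi at the points of the paths at times
   l' < k <= l1, so uniqueness of the minimizer is uniqueness there. *)
Definition unique_minimizer (c : 'rV[R]_d) (v : int -> 'rV[int]_d -> R)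
    (n : 'rV[int]_d) (l1 l' : int) (xi : control) : Prop :=
  [/\ admissible xi,
      cost c v n l1 l' xi = min_cost c v n l1 l' &
      forall xi', admissible xi' ->
        cost c v n l1 l' xi' = min_cost c v n l1 l' ->
        forall (g : walk l1 l') k, l' < k <= l1 ->
          xi' k (site n g k) = xi k (site n g k)].

(* xi*^{k+1}_m = H_p(x_m, t_k, c + (D_x v)^k_m) *)
Definition xi_star (c : 'rV[R]_d) (v : int -> 'rV[int]_d -> R) : control :=
  fun k m => Ham_p L (xpt m) (tpt (k - 1)) (c + Dx N (v (k - 1)) m).

Record standing (P : set 'rV[R]_d) (r lambda1 : R) : Prop := Standing {
  st_lambda1 : 0 < lambda1;
  st_lambda : lam < lambda1;
  st_invariant : forall c v0, P c -> Xspace N r v0 ->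
    Xspace N r (phi N K L v0 c (2 * K));
  st_dom : P `<=` Hbar_dom N K L r;
  st_xi_star : forall c v, P c -> cell_solution N K L r c v ->
    forall k m, Gtilde k m -> `|xi_star c v k m| <= (d%:R * lambda1)^-1;
  st_value : forall c v, P c -> cell_solution N K L r c v ->
    forall (n : 'rV[int]_d) (l l' : int), Gtilde (l + 1) n -> l' <= l ->
      v (l + 1) n = min_cost c v n (l + 1) l'
                    + Hbar N K L r c * (tpt (l + 1) - tpt l');
  st_minimizer : forall c v, P c -> cell_solution N K L r c v ->
    forall (n : 'rV[int]_d) (l l' : int), Gtilde (l + 1) n -> l' <= l ->
      unique_minimizer c v n (l + 1) l' (xi_star c v)
}.

End Walk.

(* Main.v *)
Require Import Defs.
From HB Require Import structures.
From mathcomp Require Import all_boot all_order all_algebra.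
From mathcomp Require Import all_classical all_reals all_analysis.
From mathcomp Require Import zify ring lra.
Import Order.TTheory GRing.Theory Num.Theory.
Import numFieldNormedType.Exports.
Local Open Scope classical_set_scope.
Local Open Scope ring_scope.
Set Implicit Arguments.
Unset Strict Implicit.
Unset Printing Implicit Defensive.

(** Near a point of differentiability the rotation vectors of the walk are
    squeezed between difference quotients of the effective Hamiltonian.

    Let xi be the minimizing control of the cell solution v at c, and let w be
    any cell solution at a nearby c'.  One step of the walk driven by xi from
    a site m changes time by -tau and, in mean, position by -tau * xi.  The
    scheme bounds w^(k+1)_m by the mean of w^k after one step plus
    tau * (L - c'.xi + Hbar c'), because the Hamiltonian is a supremum
    (Fenchel); this holds for every admissible control.  For v the same
    relation at c is an equality, because xi is optimal over one time step.
    In the difference the Lagrangian cancels and c' - c meets only the drift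
    of the walk, so that
      U^k_m = w^k_m - v^k_m + (c' - c).x_m - (Hbar c' - Hbar c) t_k
    never exceeds its mean after one step ([gap_submartingale]), hence never
    exceeds its mean along the whole walk ([submartingale]).  As v and w are
    periodic, they are bounded ([periodic_bounded]), and division by t_k < 0
    gives
      (c' - c).(mean position at k) / t_k <= Hbar c' - Hbar c + O(1 / |t_k|),
    that is, the rotation vectors are asymptotic subgradients of Hbar at c
    ([rotation_subgradient]).  Testing with c' = c + s e_j, for small s of
    both signs, forces them to converge to the gradient
    ([asymptotic_subgradient_cvg]).

    The nearby c' may lie outside P, where minimizing walks are unavailable;
    the one-sided Fenchel bound asks only for a cell solution at c'.  It is
    obtained by propagating a fixed point of the time-one map over one period
    and adding Hbar c' times the elapsed time ([exists_cell_solution]). *)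

(** * The inner product *)

Section InnerProduct.
Variables (R : realType) (d : nat).
Implicit Types (a x y : 'rV[R]_d).

Lemma dotvDr a x y : dotv a (x + y) = dotv a x + dotv a y.
Proof. by rewrite /dotv -big_split; apply: eq_bigr => j _; rewrite mxE mulrDr. Qed.

Lemma dotvZr a s x : dotv a (s *: x) = s * dotv a x.
Proof. by rewrite /dotv mulr_sumr; apply: eq_bigr => j _; rewrite mxE mulrCA. Qed.

Lemma dotvNr a x : dotv a (- x) = - dotv a x.
Proof. by rewrite -scaleN1r dotvZr mulN1r. Qed.

Lemma dotv_sumr a (I : finType) (F : I -> 'rV[R]_d) :
  dotv a (\sum_i F i) = \sum_i dotv a (F i).
Proof.
apply: big_morph; first exact: dotvDr.
by rewrite -(scale0r 0) dotvZr mul0r.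
Qed.

Lemma dotvC x y : dotv x y = dotv y x.
Proof. by apply: eq_bigr => j _; rewrite mulrC. Qed.

Lemma dotv_evecZ s j x : dotv (s *: evec R j) x = s * x 0 j.
Proof.
rewrite /dotv (bigD1 j) //= big1 => [|i /negPf Ni]; last first.
  by rewrite !mxE Ni andbF mulr0 mul0r.
by rewrite !mxE !eqxx mulr1 addr0.
Qed.

Lemma entry_le_enorm x j : `|x 0 j| <= enorm x.
Proof.
rewrite -sqrtr_sqr /enorm ler_wsqrtr // /dotv (bigD1 j) //= -expr2 lerDl.
by rewrite sumr_ge0 // => i _; rewrite -expr2 sqr_ge0.
Qed.

End InnerProduct.

(** * Parity and periods of the lattice *)

Section Lattice.
Variable d : nat.
Implicit Types (m q : 'rV[int]_d) (w : step d).

Lemma GevenD m q : Geven q -> Geven (m + q) = Geven m.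
Proof.
rewrite /Geven => Hq; under eq_bigr do rewrite mxE.
by rewrite big_split /= rpredDr.
Qed.

Lemma GevenZ2 (N : nat) q : Geven ((2 * N)%N%:Z *: q).
Proof.
rewrite /Geven; under eq_bigr do rewrite mxE.
by rewrite -mulr_sumr PoszM -mulrA dvdz_mulr.
Qed.

Lemma Geven_evec m (j : 'I_d) : Geven (m + evec int j) = ~~ Geven m.
Proof.
rewrite /Geven; under eq_bigr do rewrite !mxE.
rewrite big_split /= [X in _ + X](bigD1 j) //= !eqxx /=.
have -> : \sum_(i < d | i != j) ((i == j)%:R : int) = 0.
  by rewrite big1 // => i /negPf ->.
rewrite addr0; move: (\sum_i m 0 i) => s; lia.
Qed.

Lemma Geven_dir m w : Geven (m + dir w) = ~~ Geven m.
Proof.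
case: w => j [] /=; rewrite /dir /=; last by rewrite expr0 scale1r Geven_evec.
by rewrite expr1 scaleN1r -{2}(subrK (evec int j) m) Geven_evec negbK.
Qed.

Lemma Ggrid_pred (k : int) m : Gtilde k m -> Ggrid (k - 1) m.
Proof. by rewrite /Gtilde /Ggrid /Godd; do 2![case: ifP => ?] => //; lia. Qed.

Lemma Gtilde_dir (k : int) m w : Ggrid k m -> Gtilde k (m + dir w).
Proof. by rewrite /Ggrid /Gtilde /Godd Geven_dir; case: ifP; rewrite ?negbK. Qed.

Lemma Gtilde_shift (N : nat) (k : int) m q :
  Gtilde k (m + (2 * N)%N%:Z *: q) = Gtilde k m.
Proof. by rewrite /Gtilde /Godd GevenD ?GevenZ2. Qed.

Lemma Gtilde_time (K : nat) (k : int) m :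
  Gtilde (k + (2 * K)%N%:Z) m = Gtilde k m.
Proof. by rewrite /Gtilde PoszM rpredDr // dvdz_mulr. Qed.

Lemma sum_steps (V : nmodType) (F : step d -> V) :
  \sum_(w : step d) F w = \sum_(j < d) (F (j, false) + F (j, true)).
Proof.
rewrite (eq_bigr (fun w => F (w.1, w.2))) => [|[]] //.
rewrite -(pair_bigA _ (fun j b => F (j, b))) /=.
by apply: eq_bigr => j _; rewrite big_bool addrC.
Qed.

End Lattice.

Section PeriodicGridFunctions.
Variables (R : realType) (d N K : nat).
Hypotheses (N_gt0 : (0 < N)%N) (K_gt0 : (0 < K)%N).
Variable v : int -> 'rV[int]_d -> R.
Hypothesis v_perx : forall k m j, Gtilde k m ->
  v k (m + (2 * N)%N%:Z *: evec int j) = v k m.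
Hypothesis v_pert : forall k m, Gtilde k m -> v (k + (2 * K)%N%:Z) m = v k m.

Lemma periodic_space k m (q : 'rV[int]_d) : Gtilde k m ->
  v k (m + (2 * N)%N%:Z *: q) = v k m.
Proof.
pose S q := forall m, Gtilde k m -> v k (m + (2 * N)%N%:Z *: q) = v k m.
have S0 : S 0 by move=> m' _; rewrite scaler0 addr0.
have SD q1 q2 : S q1 -> S q2 -> S (q1 + q2).
  by move=> S1 S2 m' Gm; rewrite scalerDr addrA S2 ?Gtilde_shift // S1.
have SN q1 : S q1 -> S (- q1).
  move=> S1 m' Gm; rewrite -{2}(subrK ((2 * N)%N%:Z *: q1) m').
  by rewrite scalerN S1 // -scalerN Gtilde_shift.
have Se j : S (evec int j) by move=> m'; apply: v_perx.
have Sn (z : nat) j : S (z%:Z *: evec int j).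
  elim: z => [|z IH]; first by rewrite scale0r.
  by rewrite (_ : z.+1%:Z = z%:Z + 1) ?scalerDl ?scale1r; [apply: SD|lia].
have Sz (z : int) j : S (z *: evec int j).
  case: (intP z) => [|n|n]; [exact: Sn 0%N j | exact: Sn |].
  by rewrite scaleNr; apply/SN/Sn.
suff : S q by apply.
by rewrite (row_sum_delta q); elim/big_ind: _ => // i _; apply: Sz.
Qed.

Lemma periodic_time k m (q : int) : Gtilde k m ->
  v (k + q * (2 * K)%N%:Z) m = v k m.
Proof.
have Sn (z : nat) k' : Gtilde k' m -> Gtilde (k' + z%:Z * (2 * K)%N%:Z) m /\
    v (k' + z%:Z * (2 * K)%N%:Z) m = v k' m.
  elim: z => [|z IH] Gk; first by rewrite mul0r addr0.
  have [G1 v1] := IH Gk.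
  by rewrite -addn1 PoszD mulrDl mul1r addrA Gtilde_time v_pert.
move=> Gk; case: (intP q) => [|n|n].
- by rewrite mul0r addr0.
- by have [] := Sn n.+1 k Gk.
- have Gk' : Gtilde (k + - n.+1%:Z * (2 * K)%N%:Z) m.
    rewrite /Gtilde; move: Gk; rewrite /Gtilde.
    by rewrite rpredDr // dvdz_mull // PoszM dvdz_mulr.
  have [_ <-] := Sn n.+1 _ Gk'.
  by rewrite -addrA -mulrDl addNr mul0r addr0.
Qed.

(** A doubly periodic grid function takes finitely many values: reduce the
    indices modulo the even periods, which preserve the sublattice. *)
Lemma periodic_bounded : exists C : R, forall k m, Gtilde k m -> `|v k m| <= C.
Proof.
pose row (f : {ffun 'I_d -> 'I_(2 * N)}) : 'rV[int]_d := \row_j (f j)%:Z.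
(* The sum over one period box serves as a crude bound for the maximum. *)
exists (\sum_(k < 2 * K) \sum_(f : {ffun 'I_d -> 'I_(2 * N)}) `|v k (row f)|).
move=> k m Gm.
have N2 : (0 < 2 * N)%N by rewrite muln_gt0.
have K2 : (0 < 2 * K)%N by rewrite muln_gt0.
have kb : (`|(k %% (2 * K)%N)%Z|%N < 2 * K)%N by lia.
have mb j : (`|(m 0%R j %% (2 * N)%N)%Z|%N < 2 * N)%N by lia.
pose f : {ffun 'I_d -> 'I_(2 * N)} := [ffun j => Ordinal (mb j)].
have Ef : m = row f + (2 * N)%N%:Z *: \row_j (m 0%R j %/ (2 * N)%N)%Z.
  by apply/rowP => j; rewrite !mxE ffunE /=; lia.
have Ek : k = `|(k %% (2 * K)%N)%Z|%N%:Z + (k %/ (2 * K)%N)%Z * (2 * K)%N%:Z.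
  by lia.
have Gf : Gtilde k (row f) by move: Gm; rewrite {1}Ef Gtilde_shift.
have -> : v k m = v (Ordinal kb) (row f).
  rewrite {1}Ef periodic_space // {1}Ek periodic_time //=.
  move: Gf; rewrite /Gtilde {1}Ek rpredDr // dvdz_mull // PoszM dvdz_mulr //.
rewrite (bigD1 (Ordinal kb)) //= (bigD1 f) //= -addrA lerDl addr_ge0 //.
  by rewrite sumr_ge0.
by rewrite sumr_ge0 // => i _; rewrite sumr_ge0.
Qed.

End PeriodicGridFunctions.

(** * One step of the walk *)

Section Transition.
Variables (R : realType) (d N K : nat).
Implicit Types (z : 'rV[R]_d) (m : 'rV[int]_d) (u : 'rV[int]_d -> R).

Lemma rhoE z (j : 'I_d) (b : bool) :
  rho N K z (j, b) = (2 * d)%:R^-1 - lam R N K / 2 * ((-1) ^+ b * z 0 j).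
Proof.
rewrite /rho /dotv (bigD1 j) //= big1 => [|i /negPf Ni]; last first.
  by rewrite !mxE Ni andbF mulr0 mul0r.
by rewrite !mxE !eqxx mulr1 addr0 rmorph_sign.
Qed.

(** The transition weights are chosen so that the centred difference quotient
    and the lattice average of the scheme combine into one expectation. *)
Lemma expect_step u m z :
  \sum_(w : step d) rho N K z w * u (m + dir w)
    = avg u m - tstep R K * dotv (Dx N u m) z.
Proof.
rewrite sum_steps /avg sum_steps !mulr_sumr -sumrB; apply: eq_bigr => j _.
rewrite !rhoE /lam !mxE /dir /= expr0 expr1 scale1r scaleN1r invfM.
by ring.
Qed.

Lemma expect_step_cst (a : R) z : (0 < d)%N ->
  \sum_(w : step d) rho N K z w * a = a.
Proof.
move=> d_gt0; rewrite (expect_step (fun=> a) 0) /avg.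
have -> : dotv (Dx N (fun=> a) 0) z = 0.
  by rewrite /dotv big1 // => j _; rewrite mxE subrr !mul0r.
rewrite mulr0 subr0 sumr_const card_prod card_ord card_bool mulnC.
by rewrite -[a *+ _]mulr_natl mulKf // pnatr_eq0 -lt0n muln_gt0 d_gt0.
Qed.

(** The bound on admissible controls is exactly the one that keeps the weights
    nonnegative. *)
Lemma rho_ge0 z (w : step d) : (0 < d)%N -> (0 < N)%N -> (0 < K)%N ->
  `|z| <= (d%:R * lam R N K)^-1 -> 0 <= rho N K z w.
Proof.
move=> d0 N0 K0 zle; case: w => j b; rewrite rhoE subr_ge0.
have lam0 : 0 < lam R N K.
  by rewrite divr_gt0 ?invr_gt0 ?ltr0n ?muln_gt0.
have dR : 0 < d%:R :> R by rewrite ltr0n.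
have zj : `|z 0 j| <= (d%:R * lam R N K)^-1.
  apply: le_trans zle; rewrite [leRHS]/Num.Def.normr /= mx_normrE.
  by apply/bigmax_geP; right => /=; exists (0, j).
apply: le_trans (ler_wpM2l _ (ler_norm _)) _; first by rewrite divr_ge0 // ltW.
rewrite normrM normr_sign mul1r natrM invfM.
apply: le_trans (ler_wpM2l _ zj) _; first by rewrite divr_ge0 // ltW.
by rewrite invfM le_eqVlt; apply/orP; left; apply/eqP; field; rewrite !lt0r_neq0.
Qed.

(** The control is a velocity: going one step back in time displaces the walk
    by [- tau * z] in mean. *)
Lemma expect_step_xpt z m a : (0 < d)%N -> (0 < N)%N ->
  \sum_(w : step d) rho N K z w * dotv a (xpt R N (m + dir w))
    = dotv a (xpt R N m) - tstep R K * dotv a z.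
Proof.
move=> d0 N0; rewrite (expect_step (fun m => dotv a (xpt R N m))).
have xptD (q q' : 'rV[int]_d) : xpt R N (q + q') = xpt R N q + xpt R N q'.
  by rewrite /xpt map_mxD scalerDr.
have xptN (q : 'rV[int]_d) : xpt R N (- q) = - xpt R N q.
  by rewrite /xpt map_mxN scalerN.
have xe j : dotv a (xpt R N (evec int j)) = hstep R N * a 0 j.
  by rewrite /xpt map_delta_mx dotvC dotv_evecZ.
congr (_ - _ * _).
  rewrite /avg sum_steps.
  under eq_bigr do rewrite /dir /= expr0 expr1 scale1r scaleN1r !xptD !dotvDr
    xptN dotvNr addrACA subrr addr0 -mulr2n.
  rewrite sumr_const card_ord -mulrnA -[dotv _ _ *+ _]mulr_natl mulKf //.
  by rewrite pnatr_eq0 -lt0n muln_gt0 d0.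
apply: eq_bigr => j _; rewrite mxE !xptD !dotvDr xptN dotvNr xe.
have h0 : hstep R N != 0 by rewrite invr_eq0 pnatr_eq0 -lt0n muln_gt0 N0.
by congr (_ * _); field.
Qed.

End Transition.

(** * The law of the walk *)

Section PathLaw.
Variables (R : realType) (d N K : nat).
Variables (xi : control R d) (n : 'rV[int]_d) (l1 : int).

(** Paths are indexed here by their number of steps, whereas [walk] indexes them
    by two times; an induction on the length needs the former, because the
    length of a [walk] reduces to a successor only up to a cast. *)
Definition pathpos M (g : {ffun 'I_M -> step d}) (i : nat) : 'rV[int]_d :=
  n + \sum_(j < M | (j < i)%N) dir (g j).

Definition pathweight M (g : {ffun 'I_M -> step d}) : R :=
  \prod_(j < M) rho N K (xi (l1 - j%:Z) (pathpos g j)) (g j).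

Lemma site_pathpos (l' : int) (g : walk d l1 l') (i : nat) :
  site n g (l1 - i%:Z) = pathpos g i.
Proof.
by rewrite /site /pathpos; congr (_ + _); apply: eq_bigl => j; lia.
Qed.

Lemma density_pathweight (l' : int) (g : walk d l1 l') :
  density N K xi n g = pathweight g.
Proof. by apply: eq_bigr => j _; rewrite site_pathpos. Qed.

Definition ffrcons M (g : {ffun 'I_M -> step d}) (w : step d) :
    {ffun 'I_M.+1 -> step d} :=
  [ffun i => if unlift ord_max i is Some j then g j else w].

Lemma ffrcons_max M (g : {ffun 'I_M -> step d}) w : ffrcons g w ord_max = w.
Proof. by rewrite ffunE unlift_none. Qed.

Lemma ffrcons_widen M (g : {ffun 'I_M -> step d}) w j :
  ffrcons g w (widen_ord (leqnSn M) j) = g j.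
Proof.
rewrite ffunE (_ : widen_ord _ j = lift ord_max j) ?liftK //.
by apply: val_inj; rewrite /= /bump leqNgt ltn_ord.
Qed.

Lemma pathpos_rcons M (g : {ffun 'I_M -> step d}) w i : (i <= M)%N ->
  pathpos (ffrcons g w) i = pathpos g i.
Proof.
move=> iM; rewrite /pathpos; congr (_ + _).
rewrite big_mkcond big_ord_recr /= ltnNge iM /= addr0 [RHS]big_mkcond /=.
by apply: eq_bigr => j _; rewrite ffrcons_widen.
Qed.

Lemma pathpos_last M (g : {ffun 'I_M -> step d}) w :
  pathpos (ffrcons g w) M.+1 = pathpos g M + dir w.
Proof.
rewrite /pathpos big_mkcond big_ord_recr /= ltnSn ffrcons_max addrA.
congr (_ + _ + _); rewrite [RHS]big_mkcond; apply: eq_bigr => j _ /=.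
by rewrite ltnS ltnW // ltn_ord ffrcons_widen.
Qed.

Lemma pathweight_rcons M (g : {ffun 'I_M -> step d}) w :
  pathweight (ffrcons g w)
    = pathweight g * rho N K (xi (l1 - M%:Z) (pathpos g M)) w.
Proof.
rewrite /pathweight big_ord_recr /= pathpos_rcons // ffrcons_max.
congr (_ * _); apply: eq_bigr => j _.
by rewrite pathpos_rcons ?ffrcons_widen // ltnW.
Qed.

(** Markov property: conditioning on the first [M] steps integrates out the last
    one with the weights at the current site. *)
Lemma expect_rcons M (F : 'rV[int]_d -> R) :
  \sum_(g : {ffun 'I_M.+1 -> step d}) pathweight g * F (pathpos g M.+1)
  = \sum_(g : {ffun 'I_M -> step d}) pathweight g *
      \sum_(w : step d) rho N K (xi (l1 - M%:Z) (pathpos g M)) w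
                          * F (pathpos g M + dir w).
Proof.
under [RHS]eq_bigr do rewrite mulr_sumr.
rewrite pair_bigA /=.
pose tr (p : {ffun 'I_M -> step d} * step d) := ffrcons p.1 p.2.
pose rt (g : {ffun 'I_M.+1 -> step d}) : {ffun 'I_M -> step d} * step d :=
  ([ffun j => g (widen_ord (leqnSn M) j)], g ord_max).
rewrite (reindex tr) /=.
  by apply: eq_bigr => -[g w] _; rewrite pathweight_rcons pathpos_last mulrA.
exists rt => [[g w] _|g _].
  rewrite /rt /tr /= ffrcons_max; congr (_, _).
  by apply/ffunP => j; rewrite ffunE ffrcons_widen.
apply/ffunP => i; rewrite /tr /= ffunE.
case: unliftP => [j ->|-> //]; rewrite ffunE; congr (g _).
by apply: val_inj; rewrite /= /bump leqNgt ltn_ord.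
Qed.

Lemma Gtilde_pathpos M (g : {ffun 'I_M -> step d}) (i : nat) :
  Gtilde l1 n -> (i <= M)%N -> Gtilde (l1 - i%:Z) (pathpos g i).
Proof.
move=> Gn; elim: i => [_|i IH iM].
  by rewrite /pathpos big_pred0 // subr0 addr0.
have -> : pathpos g i.+1 = pathpos g i + dir (g (Ordinal iM)).
  rewrite /pathpos -addrA; congr (_ + _).
  rewrite (bigD1 (Ordinal iM)) //= addrC; congr (_ + _).
  apply: eq_bigl => j; rewrite ltnS -val_eqE /=; lia.
apply: Gtilde_dir; have /Ggrid_pred := IH (ltnW iM).
by congr Ggrid; lia.
Qed.

End PathLaw.

Section Submartingale.
Variables (R : realType) (d N K : nat).
Hypotheses (d_gt0 : (0 < d)%N) (N_gt0 : (0 < N)%N) (K_gt0 : (0 < K)%N).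
Variables (xi : control R d) (n : 'rV[int]_d) (l1 : int).
Hypotheses (xi_adm : admissible N K xi) (Gn : Gtilde l1 n).

Lemma pathweight_ge0 M (g : {ffun 'I_M -> step d}) :
  0 <= pathweight N K xi n l1 g.
Proof.
apply: prodr_ge0 => j _; apply: rho_ge0 => //.
by apply: xi_adm; apply: Gtilde_pathpos => //; apply: ltnW.
Qed.

Lemma expect_mass M :
  \sum_(g : {ffun 'I_M -> step d}) pathweight N K xi n l1 g = 1.
Proof.
elim: M => [|M IH].
  have : #|{ffun 'I_0 -> step d}| = 1%N by rewrite card_ffun card_ord.
  move/eqP/card1P => [g0 Hg].
  rewrite (eq_bigl (xpred1 g0)) => [|g]; last by have := Hg g; rewrite !inE.
  by rewrite big_pred1_eq /pathweight big_ord0.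
have := expect_rcons N K xi n l1 M (fun=> 1).
under eq_bigr do rewrite mulr1.
by under [in RHS]eq_bigr do rewrite expect_step_cst // mulr1; rewrite IH.
Qed.

(** A one-step inequality propagates along the walk because the path weights are
    nonnegative and the walk stays on the sublattice. *)
Lemma submartingale (U : int -> 'rV[int]_d -> R) :
  (forall k m, Gtilde k m ->
     U k m <= \sum_(w : step d) rho N K (xi k m) w * U (k - 1) (m + dir w)) ->
  forall M, U l1 n <= \sum_(g : {ffun 'I_M -> step d})
                        pathweight N K xi n l1 g * U (l1 - M%:Z) (pathpos n g M).
Proof.
move=> HU; elim=> [|M IH].
  under eq_bigr do rewrite (subr0 l1) /pathpos big_ord0 addr0.
  by rewrite -mulr_suml expect_mass mul1r.
apply: le_trans IH _; rewrite expect_rcons; apply: ler_sum => g _.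
rewrite ler_wpM2l ?pathweight_ge0 //.
have -> : l1 - M.+1%:Z = l1 - M%:Z - 1 by lia.
by apply: HU; apply: Gtilde_pathpos.
Qed.

End Submartingale.

(** * The Hamiltonian *)

Section Hamiltonian.
Variables (R : realType) (d : nat) (L : 'rV[R]_d -> R -> 'rV[R]_d -> R).
Hypothesis HL : lagrangian L.

(** Fenchel's inequality.  Superlinearity with slope the l1-norm of [p] bounds
    the set from above, so that its [sup] is a genuine supremum. *)
Lemma Ham_ge x t p z : dotv p z - L x t z <= Ham L x t p.
Proof.
pose a : R := \sum_j `|p 0 j|.
have [|b1 Hb] := lag_superlinear HL (a := a); first exact: sumr_ge0.
apply: ub_le_sup; last by exists z.
exists (- b1) => _ [y _ <-].
have dotle : dotv p y <= a * enorm y.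
  rewrite /dotv /a mulr_suml; apply: ler_sum => j _.
  apply: le_trans (ler_norm _) _.
  by rewrite normrM ler_wpM2l // entry_le_enorm.
by have := Hb x t y; lra.
Qed.

Lemma Ham_perx x t p j : Ham L (x + evec R j) t p = Ham L x t p.
Proof.
rewrite /Ham; congr (sup [set _ | _ in _]); apply/funext => z.
by rewrite (lag_perx HL).
Qed.

Lemma Ham_pert x t p : Ham L x (t + 1) p = Ham L x t p.
Proof.
rewrite /Ham; congr (sup [set _ | _ in _]); apply/funext => z.
by rewrite (lag_pert HL).
Qed.

End Hamiltonian.

(** * Solutions of the discrete cell equation *)

Section CellSolutions.
Variables (R : realType) (d N K : nat) (L : 'rV[R]_d -> R -> 'rV[R]_d -> R).
Hypothesis HL : lagrangian L.
Hypotheses (d_gt0 : (0 < d)%N) (N_gt0 : (0 < N)%N) (K_gt0 : (0 < K)%N).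
Variable r : R.

Local Notation xpt := (@xpt R d N).
Local Notation tpt := (tpt R K).
Local Notation tau := (tstep R K).
Local Notation period_x := ((2 * N)%N%:Z).
Local Notation period_t := ((2 * K)%N%:Z).

Lemma xpt_shift m j : xpt (m + period_x *: evec int j) = xpt m + evec R j.
Proof.
rewrite /xpt map_mxD scalerDr; congr (_ + _); apply/rowP => i.
rewrite !mxE /hstep; case: (_ && _); last by rewrite mulr0 rmorph0 mulr0.
by rewrite mulr1 pmulrn mulVf // pnatr_eq0 -lt0n muln_gt0 N_gt0.
Qed.

Lemma tpt_shift k : tpt (k + period_t) = tpt k + 1.
Proof.
rewrite /tpt rmorphD mulrDr; congr (_ + _).
by rewrite /tstep pmulrn mulVf // pnatr_eq0 -lt0n muln_gt0 K_gt0.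
Qed.

Lemma tptD1 k : tpt (k + 1) = tpt k + tau.
Proof. by rewrite /tpt rmorphD mulrDr mulr1. Qed.

Lemma tau_gt0 : 0 < tau.
Proof. by rewrite invr_gt0 ltr0n muln_gt0. Qed.

Lemma Ham_shift_x m j t p :
  Ham L (xpt (m + period_x *: evec int j)) t p = Ham L (xpt m) t p.
Proof. by rewrite xpt_shift Ham_perx. Qed.

Lemma Ham_shift_t x k (q : int) p :
  Ham L x (tpt (k + q * period_t)) p = Ham L x (tpt k) p.
Proof.
have Sn (n : nat) k' :
    Ham L x (tpt (k' + n%:Z * period_t)) p = Ham L x (tpt k') p.
  elim: n => [|n IH]; first by rewrite mul0r addr0.
  have -> : k' + n.+1%:Z * period_t = k' + n%:Z * period_t + period_t by lia.
  by rewrite tpt_shift Ham_pert.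
case: (intP q) => [|n|n]; first by rewrite mul0r addr0.
  exact: Sn.
by rewrite -(Sn n.+1 (k + _)) -addrA -mulrDl addNr mul0r addr0.
Qed.

(** In the scheme, [D_t w = Hbar - H]; bounding [H] from below by Fenchel turns
    [avg w - tau * (D_x w).z] into the mean of [w] after one step with control
    [z]. *)
Lemma cell_solution_le c w k m z : cell_solution N K L r c w -> Gtilde k m ->
  w k m <= \sum_(e : step d) rho N K z e * w (k - 1) (m + dir e)
           + tau * Lag_c L c (xpt m) (tpt (k - 1)) z + tau * Hbar N K L r c.
Proof.
move=> Hw /Ggrid_pred Gk; rewrite expect_step.
have := cell_eq Hw Gk; rewrite /Dt subrK => Heq.
have := Ham_ge HL (xpt m) (tpt (k - 1)) (c + Dx N (w (k - 1)) m) z.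
rewrite dotvC dotvDr !(dotvC z) => Hge.
have -> : w k m = avg (w (k - 1)) m
    + tau * (tau^-1 * (w k m - avg (w (k - 1)) m)).
  by rewrite mulVKf ?gt_eqF ?tau_gt0 // addrC subrK.
have := ler_wpM2l (ltW tau_gt0) Hge; rewrite -Heq /Lag_c; lra.
Qed.

Lemma Dx_local (u1 u2 : 'rV[int]_d -> R) m m' :
  (forall e, u1 (m + dir e) = u2 (m' + dir e)) -> Dx N u1 m = Dx N u2 m'.
Proof.
move=> E; apply/rowP => j; rewrite !mxE.
have := E (j, false); have := E (j, true).
by rewrite /dir /= expr0 expr1 scale1r scaleN1r => -> ->.
Qed.

Lemma phi_perx v0 c : Xspace N r v0 -> forall (k : nat) m j, Gtilde k m ->
  phi N K L v0 c k (m + period_x *: evec int j) = phi N K L v0 c k m.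
Proof.
move=> [per0 _]; elim=> [|k IH] m j Gm /=.
  by apply: per0; move: Gm; rewrite /Gtilde dvdz0.
have Gk : Ggrid k%:Z m.
  by have := Ggrid_pred Gm; congr Ggrid; lia.
have E e : phi N K L v0 c k (m + period_x *: evec int j + dir e)
    = phi N K L v0 c k (m + dir e).
  by rewrite addrAC IH // Gtilde_dir.
rewrite Ham_shift_x (Dx_local E); congr (_ - _); congr (_ * _).
by apply: eq_bigr => e _; exact: E.
Qed.

(** With [kr k] the remainder of [k] modulo a period, the iterates of the fixed
    point plus [Hbar * t] solve the equation inside a period; the fixed-point
    equation makes them match across the jump from [2K - 1] to [2K]. *)
Lemma exists_cell_solution c : Hbar_dom N K L r c ->
  exists w, cell_solution N K L r c w.
Proof.
move=> [Hb [Hb1 _]].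
have [v0 X0 Hfix] : is_Hbar N K L r c (Hbar N K L r c).
  by apply: getPex; exists Hb.
set H := Hbar N K L r c in Hfix *.
pose kr (k : int) : nat := `|(k %% period_t)%Z|%N.
pose w (k : int) m := phi N K L v0 c (kr k) m + H * tpt (kr k)%:Z.
have K2 : (0 < 2 * K)%N by rewrite muln_gt0.
have krE k : k = (kr k)%:Z + (k %/ period_t)%Z * period_t.
  by rewrite /kr; lia.
have krlt k : (kr k < 2 * K)%N by rewrite /kr; lia.
have odd_kr k : (2 %| (kr k)%:Z)%Z = (2 %| k)%Z.
  by rewrite {2}(krE k) rpredDr // dvdz_mull // PoszM dvdz_mulr.
have Gkr k m : Gtilde k m -> Gtilde (kr k) m by rewrite /Gtilde odd_kr.
have w0 : w 0 = v0.
  apply/funext => m; rewrite /w (_ : kr 0 = 0%N); last by rewrite /kr mod0z.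
  by rewrite /= /tpt mulr0 mulr0 addr0.
exists w; split.
- by move=> k m j Gk; rewrite /w phi_perx // Gkr.
- by move=> k m Gk; rewrite /w /kr modzDr.
- by rewrite w0.
move=> k m Gk; rewrite /Dt.
have Dw : Dx N (w k) m = Dx N (phi N K L v0 c (kr k)) m.
  by apply/rowP => j; rewrite !mxE /w opprD addrACA subrr addr0.
have Aw : avg (w k) m = avg (phi N K L v0 c (kr k)) m + H * tpt (kr k).
  rewrite /avg /w big_split mulrDr; congr (_ + _).
  rewrite sumr_const card_prod card_ord card_bool mulnC -[_ * _ *+ _]mulr_natl.
  by rewrite mulKf // pnatr_eq0 -lt0n muln_gt0 d_gt0.
have Sw : w (k + 1) m = phi N K L v0 c (kr k).+1 m + H * (tpt (kr k) + tau).
  rewrite -tptD1 /w; have [lt2K|ge2K] := ltnP (kr k).+1 (2 * K).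
    have -> : kr (k + 1) = (kr k).+1.
      by rewrite /kr -modzDml modz_small //; move: lt2K; rewrite /kr; lia.
    by rewrite (_ : (kr k).+1%:Z = (kr k)%:Z + 1) //; lia.
  have E1 : (kr k).+1 = (2 * K)%N by have := krlt k; lia.
  have E0 : kr (k + 1) = 0%N.
    rewrite /kr -modzDml (_ : (k %% period_t)%Z + 1 = period_t) ?modzz //.
    by move: E1; rewrite /kr; lia.
  have -> : (kr k : int) + 1 = 0 + period_t by lia.
  rewrite E0 E1 tpt_shift {1}/phi [tpt 0]mulr0 mulr0 addr0 add0r mulr1 Hfix //.
  (* At the end of a period [k] is odd, so [m] is a site of [v0]. *)
  have := Gk; rewrite /Ggrid (_ : (2 %| k)%Z = false) //.
  by rewrite -odd_kr; lia.
rewrite {3}(krE k) Ham_shift_t Sw Aw Dw /=.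
have t0 : tau != 0 by rewrite gt_eqF ?tau_gt0.
by rewrite -/H; field.
Qed.

End CellSolutions.

(** * The minimizing control over one time step *)

Section MinimizingWalk.
Variables (R : realType) (d N K : nat) (L : 'rV[R]_d -> R -> 'rV[R]_d -> R).
Hypotheses (d_gt0 : (0 < d)%N) (N_gt0 : (0 < N)%N) (K_gt0 : (0 < K)%N).
Variables (P : set 'rV[R]_d) (r lambda1 : R).
Hypothesis Hst : standing N K L P r lambda1.
Variables (c : 'rV[R]_d) (v : int -> 'rV[int]_d -> R).
Hypotheses (Pc : P c) (Hv : cell_solution N K L r c v).

Local Notation xi := (xi_star N K L c v).
Local Notation tau := (tstep R K).

Lemma xi_star_admissible : admissible N K xi.
Proof.
(* The minimality of [xi] from any one grid point contains its admissibility. *)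
have Gm : Gtilde (0 + 1) (0 : 'rV[int]_d).
  by rewrite /Gtilde /= /Geven big1 // => j _; rewrite mxE.
by have [] := st_minimizer Hst Pc Hv Gm (lexx _).
Qed.

(** The value formula with horizon [l' = l], where the optimal control realizes
    the infimum: the counterpart, with equality, of [cell_solution_le]. *)
Lemma cell_solution_eq k m : Gtilde k m ->
  v k m = \sum_(e : step d) rho N K (xi k m) e * v (k - 1) (m + dir e)
           + tau * Lag_c L c (xpt R N m) (tpt R K (k - 1)) (xi k m)
           + tau * Hbar N K L r c.
Proof.
move=> Gm; have Gm' : Gtilde (k - 1 + 1) m by rewrite subrK.
have Hval := st_value Hst Pc Hv Gm' (lexx _).
have [_ Hmin _] := st_minimizer Hst Pc Hv Gm' (lexx _).
move: Hval; rewrite -Hmin !subrK => ->.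
have -> : tpt R K k - tpt R K (k - 1) = tau.
  by rewrite -[in X in X - _](subrK 1 k) tptD1 addrAC subrr add0r.
rewrite [_ * tau]mulrC; congr (_ + _).
rewrite /cost /expect.
have m0 M (g : {ffun 'I_M -> step d}) : pathpos m g 0 = m.
  by rewrite /pathpos big_pred0 // addr0.
under eq_bigr => g _.
  rewrite density_pathweight (site_pathpos m g 1).
  under eq_bigr => j _ do rewrite (site_pathpos m g j).
  over.
(* The number of steps is 1 only after arithmetic; abstract it from the types. *)
have : absz (k - (k - 1))%R = 1%N by lia.
rewrite /walk; move: (absz (k - (k - 1))%R) => M -> {M}.
under eq_bigr do rewrite big_ord1 m0 subr0 mulrDr.
rewrite big_split /= -mulr_suml expect_mass // mul1r addrC mulrC; congr (_ + _).
rewrite expect_rcons; under eq_bigr do rewrite m0 subr0.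
by rewrite -mulr_suml expect_mass // mul1r.
Qed.

End MinimizingWalk.

(** * Asymptotic subgradients *)

Section AsymptoticSubgradients.
Variables (R : realType) (d : nat).

(** At a point of differentiability the gradient is the only subgradient.  In
    coordinate [j], testing with [c + h e_j] and [c - h e_j] bounds [g i] from
    above and below by difference quotients, up to an error [o(1)] as [i] grows
    with [h] fixed. *)
Lemma asymptotic_subgradient_cvg (F : 'rV[R]_d -> R) (c : 'rV[R]_d)
    (g : nat -> 'rV[R]_d) :
  differentiable F c ->
  (\forall c' \near c, forall e : R, 0 < e ->
     \forall i \near \oo, dotv (c' - c) (g i) <= F c' - F c + e) ->
  g @ \oo --> grad F c.
Proof.
move=> dF Hg; apply/cvg_ballP => e e0.
have e2 : 0 < e / 2 by rewrite divr_gt0.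
suff Hj j : \forall i \near \oo, ball (grad F c 0 j) e (g i 0 j).
  near=> i; split=> // a j; rewrite (ord1 a).
  by move: j; near: i; apply: filter_forall.
have Dj : derivable F c (evec R j) by exact: diff_derivable.
have Dq : h^-1 *: ((F \o shift c) (h *: evec R j) - F c) @[h --> 0^']
    --> grad F c 0 j by rewrite mxE; exact: Dj.
have line : h *: evec R j + c @[h --> (0 : R)] --> c.
  rewrite -[X in _ --> X](add0r c) -(scale0r (evec R j)).
  by apply: cvgD; [apply: cvgZ; [exact: cvg_id|exact: cvg_cst]|exact: cvg_cst].
have Hline := line _ Hg.
have Hq := (cvgrPdist_lt _ _).1 Dq _ e2.
(* One radius serves the difference quotient and the subgradient property. *)
have [del del0 Hdel] : exists2 del : R, 0 < del & forall h, `|h| < del -> h != 0 ->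
    `|grad F c 0 j - h^-1 *: ((F \o shift c) (h *: evec R j) - F c)| < e / 2 /\
    forall e : R, 0 < e -> \forall i \near \oo,
      dotv (h *: evec R j + c - c) (g i) <= F (h *: evec R j + c) - F c + e.
  have Hq0 : \forall h \near (0 : R), h != 0 ->
      `|grad F c 0 j - h^-1 *: ((F \o shift c) (h *: evec R j) - F c)| < e / 2.
    exact: Hq.
  have /nbhs_ballP[d1 /= d10 H1] := Hq0.
  have /nbhs_ballP[d2 /= d20 H2] := Hline.
  exists (Num.min d1 d2) => [|h]; first by rewrite lt_min d10.
  rewrite lt_min => /andP[h1 h2] hn0; split.
    by apply: H1 => //; rewrite /ball /= sub0r normrN.
  by apply: H2; rewrite /ball /= sub0r normrN.
have h2 : 0 < del / 2 by rewrite divr_gt0.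
have hlt : del / 2 < del by rewrite ltr_pdivrMr // ltr_pMr // ltr1n.
have [qp gp] := Hdel (del / 2) ltac:(by rewrite gtr0_norm)
  ltac:(by rewrite gt_eqF).
have [qn gn] := Hdel (- (del / 2)) ltac:(by rewrite normrN gtr0_norm)
  ltac:(by rewrite oppr_eq0 gt_eqF).
(* The admissible error is scaled by [h], so that it costs [e / 2] after
   division by [h]. *)
have eh : 0 < del / 2 * (e / 2) by rewrite mulr_gt0.
near=> i.
have : dotv (del / 2 *: evec R j + c - c) (g i)
    <= F (del / 2 *: evec R j + c) - F c + del / 2 * (e / 2).
  by near: i; exact: gp.
have : dotv (- (del / 2) *: evec R j + c - c) (g i)
    <= F (- (del / 2) *: evec R j + c) - F c + del / 2 * (e / 2).
  by near: i; exact: gn.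
rewrite !addrK !dotv_evecZ => ln lp.
move: qp qn; rewrite /= !ltr_distlC => /andP[_ qp] /andP[qn _].
move: qp qn.
set h := del / 2 in h2 ln lp *.
set A := F _ - F c in lp *; set B := F _ - F c in ln *.
rewrite invrN scaleNr /GRing.scale /= => qp qn.
have lp' : g i 0 j <= h^-1 * A + e / 2.
  by rewrite -(ler_pM2l h2) mulrDr mulVKf ?gt_eqF.
have ln' : - (h^-1 * B) - e / 2 <= g i 0 j.
  rewrite -(ler_pM2l h2) mulrBr mulrN mulVKf ?gt_eqF //; lra.
rewrite /ball /= ltr_distlC; apply/andP; split; lra.
Unshelve. all: by end_near.
Qed.

End AsymptoticSubgradients.

(** * Rotation vectors *)

Section RotationVector.
Variables (R : realType) (d N K : nat) (L : 'rV[R]_d -> R -> 'rV[R]_d -> R).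
Hypotheses (d_gt0 : (0 < d)%N) (N_gt0 : (0 < N)%N) (K_gt0 : (0 < K)%N).
Hypothesis HL : lagrangian L.
Variables (P : set 'rV[R]_d) (r lambda1 : R).
Hypothesis Hst : standing N K L P r lambda1.
Variables (c : 'rV[R]_d) (v : int -> 'rV[int]_d -> R).
Hypotheses (Pc : P c) (Hv : cell_solution N K L r c v).

Local Notation xi := (xi_star N K L c v).
Local Notation Hbar := (Hbar N K L r).

(** Subtracting the equality for [v] from the inequality for [w] leaves
    [tau * (Hbar c' - Hbar c - (c' - c).xi)]; the time term absorbs the first
    part and the position term, whose mean drifts by [- tau * xi], the second. *)
Lemma gap_submartingale c' w k m : cell_solution N K L r c' w ->
  let U k m := w k m - v k m + dotv (c' - c) (xpt R N m)
               - (Hbar c' - Hbar c) * tpt R K k in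
  Gtilde k m ->
  U k m <= \sum_(e : step d) rho N K (xi k m) e * U (k - 1) (m + dir e).
Proof.
move=> Hw U Gm.
have -> : \sum_(e : step d) rho N K (xi k m) e * U (k - 1) (m + dir e)
  = \sum_(e : step d) rho N K (xi k m) e * w (k - 1) (m + dir e)
    - \sum_(e : step d) rho N K (xi k m) e * v (k - 1) (m + dir e)
    + (dotv (c' - c) (xpt R N m) - tstep R K * dotv (c' - c) (xi k m))
    - (Hbar c' - Hbar c) * tpt R K (k - 1).
  rewrite -expect_step_xpt //.
  rewrite -[(_ - _) * tpt R K (k - 1)](expect_step_cst N K _ (xi k m)) //.
  rewrite -sumrB -big_split -sumrB /=; apply: eq_bigr => e _.
  by rewrite /U; ring.
have := cell_solution_le HL K_gt0 (xi k m) Hw Gm.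
have := cell_solution_eq d_gt0 N_gt0 K_gt0 Hst Pc Hv Gm.
rewrite [dotv (c' - c) (xi k m)]dotvC dotvDr dotvNr !(dotvC (xi k m)).
have tk : tpt R K k = tpt R K (k - 1) + tstep R K by rewrite -tptD1 subrK.
by rewrite /U /Lag_c tk => -> Hle; lra.
Qed.

(** The submartingale inequality, with the bounded part [w - v] moved into the
    constant, which does not depend on how far back the walk is followed. *)
Lemma gamma_bar_ge c' w n l1 : cell_solution N K L r c' w -> Gtilde l1 n ->
  exists C : R, forall i : nat, - i%:Z <= l1 ->
    C <= dotv (c' - c) (gamma_bar N K xi n l1 (- i%:Z))
         - (Hbar c' - Hbar c) * tpt R K (- i%:Z).
Proof.
move=> Hw Gn.
have [Cw Bw] := periodic_bounded N_gt0 K_gt0 (cell_perx Hw) (cell_pert Hw).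
have [Cv Bv] := periodic_bounded N_gt0 K_gt0 (cell_perx Hv) (cell_pert Hv).
pose U k m := w k m - v k m + dotv (c' - c) (xpt R N m)
               - (Hbar c' - Hbar c) * tpt R K k.
exists (U l1 n - (Cw + Cv)) => i il1.
have adm := xi_star_admissible Hst Pc Hv.
have sub := submartingale d_gt0 N_gt0 K_gt0 adm Gn (U := U)
  (fun k m => @gap_submartingale c' w k m Hw).
rewrite lerBlDr; apply: le_trans (sub (absz (l1 - - i%:Z)%R)) _.
have -> : l1 - (absz (l1 - - i%:Z)%R)%:Z = - i%:Z by lia.
set M := absz _.
have -> : dotv (c' - c) (gamma_bar N K xi n l1 (- i%:Z))
    = \sum_(g : {ffun 'I_M -> step d}) pathweight N K xi n l1 g
        * dotv (c' - c) (xpt R N (pathpos n g M)).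
  rewrite /gamma_bar /mean dotv_sumr; apply: eq_bigr => g _.
  rewrite dotvZr density_pathweight.
  have -> // : site n g (- i%:Z) = pathpos n g M.
  by rewrite -(site_pathpos n g M); congr site; rewrite /M; lia.
have mass := expect_mass N K d_gt0 xi n l1 M.
(* Write the constants as means, to compare path by path. *)
rewrite -[X in _ <= _ - X + _]mul1r -[X in _ <= _ + X]mul1r -mass.
rewrite !mulr_suml -sumrB -big_split.
apply: ler_sum => g _ /=; rewrite -mulrBr -mulrDr ler_wpM2l ?pathweight_ge0 //.
have GM : Gtilde (- i%:Z) (pathpos n g M).
  have := Gtilde_pathpos g Gn (leqnn M); congr Gtilde; rewrite /M; lia.
have := Bw _ _ GM; have := Bv _ _ GM.
rewrite !ler_norml => /andP[v1 v2] /andP[w1 w2].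
by rewrite /U; lra.
Qed.

(** Divide the previous bound by the time reached; since it is negative the
    inequality turns around, and the constant contributes [O(1/i)]. *)
Lemma rotation_subgradient c' n l1 (e : R) :
  Hbar_dom N K L r c' -> Gtilde l1 n -> 0 < e -> \forall i \near \oo,
    dotv (c' - c) ((tpt R K (- i%:Z))^-1 *: gamma_bar N K xi n l1 (- i%:Z))
      <= Hbar c' - Hbar c + e.
Proof.
move=> /exists_cell_solution[//|//|//|//|w Hw] Gn e0.
have [C HC] := gamma_bar_ge Hw Gn.
have tau0 : 0 < tstep R K := tau_gt0 R K_gt0.
near=> i.
have i0 : (0 < i)%N by near: i; exact: nbhs_infty_gt.
have il : - i%:Z <= l1.
  have : (absz l1 <= i)%N by near: i; exact: nbhs_infty_ge.
  lia.
have iC : `|C| / (e * tstep R K) <= i%:R by near: i; exact: nbhs_infty_ger.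
have := HC i il; rewrite dotvZr.
set D := dotv _ _.
have ti : 0 < tstep R K * i%:R by rewrite mulr_gt0 ?ltr0n.
have -> : tpt R K (- i%:Z) = - (tstep R K * i%:R) by rewrite /tpt rmorphN mulrN.
move=> HD; rewrite invrN mulNr lerNl -(ler_pM2l ti) mulVKf ?gt_eqF //.
have := ler_norm (- C); rewrite normrN => nC.
move: iC; rewrite ler_pdivrMr ?mulr_gt0 // => iC.
by lra.
Unshelve. all: by end_near.
Qed.

End RotationVector.

Theorem theorem3p3 (R : realType) (d : nat) (d_gt0 : (0 < d)%N)
    (L : 'rV[R]_d -> R -> 'rV[R]_d -> R) (HL : lagrangian L)
    (P : set 'rV[R]_d) (P_compact : compact P) (P_convex : convex_set P)
    (r : R) (r_gt0 : 0 < r)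
    (N K : nat) (N_gt0 : (0 < N)%N) (K_gt0 : (0 < K)%N)
    (lambda1 : R) (Hst : standing N K L P r lambda1)
    (c : 'rV[R]_d) (Pc : P c) (Hdiff : Hbar_differentiable N K L r c)
    (v : int -> 'rV[int]_d -> R) (Hv : cell_solution N K L r c v)
    (n : 'rV[int]_d) (l : int) (Hnl : Gtilde (l + 1) n) :
  (fun i : nat =>
     (tpt R K (- i%:Z))^-1 *:
       gamma_bar N K (xi_star N K L c v) n (l + 1) (- i%:Z))
    @ \oo --> grad (Hbar N K L r) c.
Proof.
have [near_dom dH] := Hdiff.
apply: asymptotic_subgradient_cvg dH _.
near=> c' => e e0; apply: (rotation_subgradient _ _ _ _ Hst) => //.
by near: c'.
Unshelve. all: by end_near.
Qed.
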